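(* If $G$ is a stepwise transmission irregular (STI) graph of order $n$, then $$\min\{\mathrm{Tr}_G(v) : v\in V(G)\} \ge \frac{3n-5}{2}.$$ Moreover, equality holds if and only if $G\cong K_{\frac{n-1}{2},\frac{n+1}{2}}$.
   Context: All graphs are simple and connected. The order of a graph is its number of vertices. The distance $d_G(u,v)$ is the number of edges on a shortest $u,v$-path. The transmission $\mathrm{Tr}_G(v)$ of a vertex $v$ is the sum of the distances between $v$ and all other vertices of $G$. A graph $G$ is stepwise transmission irregular (STI) if $|\mathrm{Tr}_G(u)-\mathrm{Tr}_G(v)|=1$ for every edge $uv\in E(G)$. $K_{p,q}$ denotes the complete bipartite graph with parts of sizes $p$ and $q$. *)

(* Defs.v *)
From HB Require Import structures.
From mathcomp Require Import all_boot all_order all_algebra.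
Set Implicit Arguments.
Unset Strict Implicit.
Unset Printing Implicit Defensive.
Import Order.TTheory GRing.Theory Num.Theory.

Record sgraph := SGraph {
  vertex :> finType;
  adj : rel vertex;
  adj_sym : symmetric adj;
  adj_irrefl : irreflexive adj }.

Definition connected (G : sgraph) : Prop :=
  0 < #|G| /\ forall u v : G, connect (@adj G) u v.

(* A path with k edges is its start vertex u followed by a k-tuple. *)
Definition has_path (G : sgraph) (u v : G) (k : nat) : bool :=
  [exists p : k.-tuple G,
    [&& path (@adj G) u p, uniq (u :: p) & last u p == v]].

(* A path has fewer than #|G| edges, so the search below finds the length of
   a shortest one; the value is #|G| when there is no u,v-path. *)
Definition dist (G : sgraph) (u v : G) : nat :=
  find (has_path u v) (iota 0 #|G|).

Definition transmission (G : sgraph) (v : G) : nat :=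
  \sum_(u : G | u != v) dist v u.

(* The default value is an upper bound of all transmissions, so this is the
   minimum over the vertices as soon as G has a vertex. *)
Definition min_transmission (G : sgraph) : nat :=
  \big[minn / (\max_(v : G) transmission v)]_(v : G) transmission v.

Definition sti (G : sgraph) : Prop :=
  forall u v : G, adj u v ->
    (`|(transmission u)%:Z - (transmission v)%:Z| = 1)%R.

Definition isomorphic (G H : sgraph) : Prop :=
  exists2 f : G -> H, bijective f & forall u v : G, adj (f u) (f v) = adj u v.

Definition Kpq_adj (p q : nat) : rel ('I_p + 'I_q) :=
  fun x y => match x, y with
             | inl _, inr _ | inr _, inl _ => true
             | _, _ => false
             end.

Lemma Kpq_adj_sym (p q : nat) : symmetric (@Kpq_adj p q).
Proof. by move=> [i|i] [j|j]. Qed.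

Lemma Kpq_adj_irrefl (p q : nat) : irreflexive (@Kpq_adj p q).
Proof. by move=> [i|i]. Qed.

Definition Kpq (p q : nat) : sgraph :=
  SGraph (@Kpq_adj_sym p q) (@Kpq_adj_irrefl p q).

(* Main.v *)
(** Along an edge the transmission changes by one, so the parity of the
    transmission is a proper 2-colouring and no vertex [x] is equidistant from
    the ends of an edge [vu].  Hence [Tr u - Tr v] counts the vertices closer to
    [v] minus those closer to [u], and at most [(n + 1) / 2] vertices are closer
    to [v].  Among these are [v] and its neighbours other than [u], so
    [deg v <= (n + 1) / 2]; conclude by [Tr v >= deg v + 2 (n - 1 - deg v)].
    In the equality case the vertices closer to [v] than [u] are exactly those
    just listed, so every vertex at distance two from [v] is adjacent to every
    neighbour [u] of [v]. *)
Require Import Defs.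
From mathcomp Require Import all_boot all_order all_algebra.
From mathcomp Require Import zify lra.
Import Order.TTheory GRing.Theory Num.Theory.
Local Open Scope ring_scope.

(** * Shortest paths, distance and minimum transmission *)

Section Distance.
Set Implicit Arguments.
Unset Strict Implicit.
Local Open Scope nat_scope.
Variable G : sgraph.
Implicit Types (u v x : G) (p : seq G).

(** Without repetitions [u :: p] has at most [#|G|] entries, so its length falls in the range
    searched by [dist]. *)
Lemma uniq_has_path u p : path (@adj G) u p -> uniq (u :: p) ->
  has_path u (last u p) (size p) /\ size p < #|G|.
Proof.
move=> pp up; split.
  by apply/existsP; exists (in_tuple p); rewrite pp up eqxx.
by have := max_card [in u :: p]; rewrite (card_uniqP up).
Qed.

(** Here [p] may repeat vertices; it is first shortened to a path without repetitions. *)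
Lemma dist_le_path u p : path (@adj G) u p -> dist u (last u p) <= size p.
Proof.
case/shortenP => q pq uq sqp; have [hq ltq] := uniq_has_path pq uq.
apply: (@leq_trans (size q)); last first.
  by apply: (uniq_leq_size _ sqp); case/andP: uq.
rewrite leqNgt; apply/negP => /(before_find 0).
by rewrite nth_iota // add0n hq.
Qed.

Lemma dist_path u v : connect (@adj G) u v ->
  exists p, [/\ path (@adj G) u p, last u p = v & size p = dist u v].
Proof.
case/connectP => p0 /shortenP[q pq uq _] ->.
have [hq ltq] := uniq_has_path pq uq.
have has_q : has (has_path u (last u q)) (iota 0 #|G|).
  by apply/hasP; exists (size q); rewrite ?mem_iota.
have := nth_find 0 has_q; rewrite nth_iota; last first.
  by move: has_q; rewrite has_find size_iota.
case/existsP => p /and3P[pp _ /eqP lp].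
by exists p; split; rewrite ?size_tuple.
Qed.

Lemma distxx u : dist u u = 0.
Proof. by apply/eqP; rewrite -leqn0; apply: (@dist_le_path u [::]). Qed.

Lemma transmissionE v : transmission v = \sum_(x : G) dist v x.
Proof. by rewrite (bigD1 v) //= distxx. Qed.

Lemma min_transmission_le v : min_transmission G <= transmission v.
Proof.
rewrite /min_transmission; move: (\max_u _) (mem_index_enum v) => m.
elim: (index_enum _) => // y s IHs; rewrite inE big_cons ssrnat.geq_min.
by case/predU1P => [->|/IHs ->]; rewrite ?leqnn ?orbT.
Qed.

Lemma min_transmission_attained :
  0 < #|G| -> exists v, min_transmission G = transmission v.
Proof.
move=> G_gt0; rewrite /min_transmission.
apply: (big_ind (fun m => exists v, m = transmission v)) => [|m1 m2 h1 h2|v _].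
(* The default value is a maximum over a nonempty vertex set, hence itself a transmission. *)
- by have [v ->] := bigop.eq_bigmax (@transmission G) G_gt0; exists v.
- by rewrite /minn; case: ifP.
- by exists v.
Qed.

Hypothesis conn : forall u v, connect (@adj G) u v.

Lemma dist_eq0 u v : (dist u v == 0) = (u == v).
Proof.
apply/eqP/eqP => [d0|->]; last exact: distxx.
have [p [_]] := dist_path (conn u v).
by rewrite d0 => <- /size0nil ->.
Qed.

Lemma dist_eq1 u v : (dist u v == 1) = adj u v.
Proof.
apply/eqP/idP => [d1|uv].
  have := dist_path (conn u v); rewrite d1 => -[[|x [|y p]] [//= + <- _]].
  by rewrite andbT.
have := @dist_le_path u [:: v]; rewrite /= uv => /(_ isT).
have := dist_eq0 u v; have [uv0|_] := eqVneq u v; last by lia.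
by move: uv; rewrite uv0 adj_irrefl.
Qed.

Lemma dist_adj_le u v x : adj u v -> dist u x <= (dist v x).+1.
Proof.
move=> uv; have [p [pp lp <-]] := dist_path (conn v x).
by have := @dist_le_path u (v :: p); rewrite /= uv pp lp => /(_ isT).
Qed.

(** The corrections lift the distances 1 and 0 to 2. Summed over [x], this compares the transmission
    with the degree of [v]. *)
Lemma dist_ge2 v x : 2 <= dist v x + adj v x + (v == x).*2.
Proof.
rewrite -dist_eq0 -dist_eq1.
by case: (dist v x) => [|[|d]].
Qed.

Lemma ex_neighbour v : 1 < #|G| -> exists u, adj v u.
Proof.
case/card_gt1P => x [y [_ _ xy]].
have [w vw] : exists w, v != w.
  by case: (eqVneq v x) => [->|vx]; [exists y | exists x].
have [[|u p] [/=]] := dist_path (conn v w).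
  by move=> _ vw0; rewrite vw0 eqxx in vw.
by case/andP => vu _ _ _; exists u.
Qed.

End Distance.

(** * Parity, degree bound and extremal case for STI graphs *)

Section StepwiseTransmissionIrregular.
Set Implicit Arguments.
Unset Strict Implicit.
Local Open Scope nat_scope.
Variable G : sgraph.
Implicit Types u v x : G.
Hypothesis conn : forall u v : G, connect (@adj G) u v.
Hypothesis stiG : sti G.

Lemma sti_odd_adj u v :
  adj u v -> odd (transmission u) = ~~ odd (transmission v).
Proof. by move=> /stiG; lia. Qed.

(** Each edge of a walk from [u] to [x] flips the parity of the transmission. *)
Lemma sti_odd_dist u x :
  odd (dist u x) = odd (transmission u) (+) odd (transmission x).
Proof.
have [p [pp <- <-]] := dist_path (conn u x).
elim: p u pp => [|y p IHp] u /=; first by rewrite addbb.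
by case/andP => /sti_odd_adj -> /IHp ->; rewrite addNb.
Qed.

(** The two distances differ by at most one and have opposite parity, so they differ by exactly one.
    Truth values used as numbers put both signs into one equation, ready for summation. *)
Lemma sti_dist_adj v u x : adj v u ->
  dist u x + ~~ (dist v x < dist u x) = dist v x + (dist v x < dist u x).
Proof.
move=> vu; have uv : adj u v by rewrite adj_sym.
have := sti_odd_dist u x; have := sti_odd_dist v x.
have := dist_adj_le conn x uv; have := dist_adj_le conn x vu.
by rewrite (sti_odd_adj vu); lia.
Qed.

Definition closer v u : {set G} := [set x | dist v x < dist u x].

Definition nbhd v : {set G} := [set x | adj v x].

Lemma sti_card_closer v u : adj v u -> (#|closer v u|).*2 <= #|G|.+1.
Proof.
move=> vu.
(* Thus [Tr u - Tr v] is twice the size of [closer v u] minus the order, and it is 1 or -1. *)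
have E : transmission u + #|~: closer v u| = transmission v + #|closer v u|.
  rewrite !transmissionE -!sum1_card !(big_mkcond (fun x => x \in _)).
  rewrite -!big_split /=; apply: eq_bigr => x _.
  by rewrite !inE; apply: sti_dist_adj.
by have := cardsC (closer v u); move: (stiG vu); lia.
Qed.

Lemma sti_closer_sub v u : adj v u -> v |: (nbhd v :\ u) \subset closer v u.
Proof.
move=> vu; apply/subsetP => x; rewrite !inE.
case/predU1P => [->|/andP[xu vx]].
  rewrite distxx lt0n dist_eq0 //.
  by apply: contraTneq vu => ->; rewrite adj_irrefl.
(* Both [u] and [x] are neighbours of [v], so their distance is even; being nonzero, it exceeds
   [dist v x = 1]. *)
have := sti_odd_dist u x; have := sti_odd_adj vu; have := sti_odd_adj vx.
move: vx; rewrite -(dist_eq1 conn) => /eqP ->.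
by have := dist_eq0 conn u x; rewrite [u == x]eq_sym (negbTE xu); lia.
Qed.

Lemma card_setU1_nbhdD1 v u : adj v u -> #|v |: (nbhd v :\ u)| = #|nbhd v|.
Proof.
move=> vu; rewrite cardsU1 !inE adj_irrefl andbF /=.
by rewrite [RHS](cardsD1 u) inE vu.
Qed.

Lemma sti_degree v u : adj v u -> (#|nbhd v|).*2 <= #|G|.+1.
Proof.
move=> vu; apply: leq_trans (sti_card_closer vu).
by rewrite leq_double -(card_setU1_nbhdD1 vu) subset_leq_card // sti_closer_sub.
Qed.

Lemma sum_dist_nbhd v :
  \sum_x (dist v x + adj v x + (v == x).*2) = transmission v + #|nbhd v| + 2.
Proof.
rewrite !big_split /= transmissionE; congr (_ + _ + _).
  by rewrite -sum1_card [RHS]big_mkcond; apply: eq_bigr => x _; rewrite inE; case: adj.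
rewrite (bigD1 v) //= eqxx big1 // => x; rewrite eq_sym.
by move=> /negbTE ->.
Qed.

Lemma transmission_degree v : #|G|.*2 <= transmission v + #|nbhd v| + 2.
Proof.
rewrite -sum_dist_nbhd -muln2 -sum_nat_const.
by apply: leq_sum => x _; apply: dist_ge2.
Qed.

(** Equality of the sums forces equality in each term of [dist_ge2], so every vertex is within
    distance two of [v]. *)
Lemma transmission_degree_eq v x : #|G|.*2 = transmission v + #|nbhd v| + 2 ->
  dist v x + adj v x + (v == x).*2 = 2.
Proof.
rewrite -sum_dist_nbhd -muln2 -sum_nat_const => E.
have [_] : \sum_(y : G) 2 <= \sum_y (dist v y + adj v y + (v == y).*2)
    ?= iff [forall y, 2 == dist v y + adj v y + (v == y).*2].
  by apply: leqif_sum => y _; split; rewrite ?dist_ge2.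
by rewrite E eqxx => /esym/forallP/(_ x)/eqP.
Qed.

Lemma sti_transmission_ge v : 3 * #|G| <= 2 * transmission v + 5.
Proof.
have := transmission_degree v.
(* A single vertex has no neighbour, but there [3 <= 5] suffices. *)
case: (leqP #|G| 1) => [|/(@ex_neighbour _ conn v)[u /sti_degree]]; lia.
Qed.

Lemma sti_transmission_eq v : 3 * #|G| = 2 * transmission v + 5 ->
  (#|nbhd v|).*2 = #|G|.+1 /\
  forall a b : G, adj a b = (a \in nbhd v) (+) (b \in nbhd v).
Proof.
move=> trE; have G_gt1 : 1 < #|G| by lia.
have degE : (#|nbhd v|).*2 = #|G|.+1.
  have [u /sti_degree] := ex_neighbour conn v G_gt1.
  by have := transmission_degree v; lia.
split=> //.
have dist2 x : dist v x + adj v x + (v == x).*2 = 2.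
  by apply: transmission_degree_eq; lia.
(* Distances from [v] are 0, 1 or 2, so the odd ones belong exactly to the neighbours: [nbhd v] is a
   parity class. *)
have side x : (x \in nbhd v) = odd (transmission v) (+) odd (transmission x).
  rewrite inE -sti_odd_dist; have := dist2 x.
  by rewrite -(dist_eq1 conn) -(dist_eq0 conn); lia.
have cross a b : a \in nbhd v -> b \notin nbhd v -> adj a b.
  rewrite inE => va nvb; have [<-|vb] := eqVneq v b; first by rewrite adj_sym.
  (* The extremal degree leaves no room in the inclusion [sti_closer_sub]. *)
  have closerE : v |: (nbhd v :\ a) = closer v a.
    apply/eqP; rewrite eqEcard sti_closer_sub // card_setU1_nbhdD1 //.
    by have := sti_card_closer va; rewrite -degE leq_double.
  have dvb : dist v b = 2.
    by have := dist2 b; move: nvb; rewrite inE (negbTE vb) => /negbTE ->; lia.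
  have odd_ab : odd (dist a b).
    have := side a; have := side b.
    rewrite (negbTE nvb) [a \in _]inE va sti_odd_dist.
    by case: (odd _) (odd _) (odd _) => [] [] [].
  (* Hence [dist a b <= dist v b = 2], and an odd distance at most two is 1. *)
  have : b \notin closer v a.
    by rewrite -closerE in_setU1 in_setD1 eq_sym (negbTE vb) (negbTE nvb) andbF.
  rewrite [b \in closer v a]inE -(dist_eq1 conn) -leqNgt dvb.
  by case: (dist a b) odd_ab => [|[|[|d]]].
move=> a b; apply/idP/idP => [ab|].
  by rewrite !side (sti_odd_adj ab); lia.
have [ha|ha] := boolP (a \in nbhd v); have [hb|hb] := boolP (b \in nbhd v) => //.
  by rewrite cross.
by rewrite adj_sym cross.
Qed.

End StepwiseTransmissionIrregular.

(** * Recognising complete bipartite graphs and bounding their transmission *)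

Section CompleteBipartite.
Set Implicit Arguments.
Unset Strict Implicit.
Local Open Scope nat_scope.
Variable G : sgraph.

Lemma isomorphic_Kpq (B : {set G}) :
  (forall a b : G, adj a b = (a \in B) (+) (b \in B)) ->
  isomorphic G (Kpq #|~: B| #|B|).
Proof.
move=> adjE.
pose g (y : Kpq #|~: B| #|B|) : G :=
  match y with inl i => enum_val i | inr j => enum_val j end.
have gB y : (g y \in B) = ~~ is_inl y.
  case: y => [i|j] /=; last exact: enum_valP.
  by apply/negbTE; have := enum_valP i; rewrite inE.
have g_inj : injective g.
  move=> y z gyz; have := gB y; rewrite gyz gB.
  by move: gyz; case: y z => [i|j] [i'|j'] //= /enum_val_inj ->.
(* The enumeration [g] of the two parts is injective between sets of equal size; its inverse [f] is
   the isomorphism. *)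
have [|f gK fK] := inj_card_bij g_inj.
  by rewrite card_sum !card_ord addnC cardsC.
exists f; first by exists g.
move=> a b; rewrite -[in RHS](fK a) -[in RHS](fK b) adjE !gB.
by case: (f a) (f b) => [?|?] [?|?].
Qed.

(** A vertex in the part of size [p] has [q] neighbours and reaches the other [p - 1] vertices in
    two steps. *)
Lemma Kpq_transmission_le p q : 0 < p -> 0 < q -> isomorphic G (Kpq p q) ->
  #|G| = p + q /\ exists v : G, transmission v + 2 <= 2 * p + q.
Proof.
move=> p_gt0 q_gt0 [f f_bij adjE].
have cardG : #|G| = p + q by rewrite (bij_eq_card f_bij) card_sum !card_ord.
split=> //; case: f_bij => g fK gK.
have adj_g y z : adj (g y) (g z) = Kpq_adj y z by rewrite -adjE !gK.
pose v := g (inl (Ordinal p_gt0)); pose w := g (inr (Ordinal q_gt0)).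
exists v.
have nbhdE : nbhd v = [set g (inr j) | j : 'I_q].
  apply/setP => x; rewrite inE; apply/idP/imsetP => [|[j _ ->]]; last first.
    by rewrite adj_g.
  by rewrite -[x]fK adj_g; case: (f x) => // j _; exists j.
have card_nbhd : #|nbhd v| = q.
  rewrite nbhdE card_imset ?card_ord // => j j' /(can_inj gK).
  by case.
have dist2 x : dist v x + adj v x + (v == x).*2 <= 2.
  have [<-|vx] := eqVneq v x; first by rewrite distxx adj_irrefl.
  case vx1: (adj v x).
    by have := @dist_le_path G v [:: x]; rewrite /= vx1 => /(_ isT); lia.
  (* A non-neighbour [x] lies in the part of [v], so [w] from the other part is a common
     neighbour. *)
  have := @dist_le_path G v [:: w; x]; rewrite /= adj_g /=.
  suff -> : adj w x by move=> /(_ isT); lia.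
  by move: vx1; rewrite -[x]fK !adj_g; case: (f x).
have : \sum_x (dist v x + adj v x + (v == x).*2) <= #|G| * 2.
  by rewrite -sum_nat_const; apply: leq_sum => x _.
by rewrite sum_dist_nbhd card_nbhd cardG; lia.
Qed.

End CompleteBipartite.

Theorem theorem3p5 (G : sgraph) (n : nat) (hn : #|G| = n)
    (hconn : connected G) (hsti : sti G) :
  ((min_transmission G)%:R >= (3 * n%:R - 5) / 2 :> rat) /\
  ((min_transmission G)%:R = (3 * n%:R - 5) / 2 :> rat <->
   exists p q : nat,
     [/\ (0 < p)%N, (0 < q)%N,
         p%:R = (n%:R - 1) / 2 :> rat,
         q%:R = (n%:R + 1) / 2 :> rat
       & isomorphic G (Kpq p q)]).
Proof.
case: hconn => G_gt0 conn.
have natE (a b : nat) : a = b -> a%:R = b%:R :> rat by move=> ->.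
have [v minE] := min_transmission_attained G_gt0.
have := sti_transmission_ge conn hsti v; rewrite -minE hn => ge_min.
have ge_minQ : (3 * n%:R <= 2 * (min_transmission G)%:R + 5 :> rat).
  by rewrite -!natrM -natrD ler_nat.
split; first by lra.
split=> [minQ|[p [q [p_gt0 q_gt0 pE qE isoG]]]].
  have eq_min : (3 * n = 2 * min_transmission G + 5)%N.
    by apply/eqP; rewrite -(eqr_nat rat) natrD !natrM; apply/eqP; lra.
  have [|degE adjE] := sti_transmission_eq conn hsti (v := v).
    by rewrite hn -minE.
  have cardB := cardsC (nbhd v); rewrite hn in degE cardB.
  have /natE := degE; rewrite -addnn -natr1 natrD => degQ.
  have /natE := cardB; rewrite natrD => cardQ.
  (* The degree [(n + 1) / 2] is the larger part; [eq_min] gives [n >= 2], so the other part is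
     nonempty too. *)
  exists #|~: nbhd v|, #|nbhd v|; split.
  - by lia.
  - by lia.
  - by lra.
  - by lra.
  - exact: isomorphic_Kpq.
have [cardG [u tr_u]] := Kpq_transmission_le p_gt0 q_gt0 isoG.
(* Now [n = 2p + 1], and the bound [2p + q - 2 = 3p - 1] on the transmission of [u] equals
   [(3n - 5) / 2]. *)
have qpE : q = p.+1 by apply/eqP; rewrite -(eqr_nat rat) -natr1; apply/eqP; lra.
have min_u := min_transmission_le u.
have /natE : (2 * min_transmission G + 5 = 3 * n)%N by lia.
by rewrite natrD !natrM; lra.
Qed.
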